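(* Let $(\mathbf r,\mathbf h)$ be a pattern, with $\mathbf r=(r_1,\dots,r_t)$ and $\mathbf h=(h_1,\dots,h_t)$, and let $H=\sum_{j=1}^t h_j$ and $B=\sum_{j=1}^t h_j|r_j|$. Let $n\ge 2$ be an integer satisfying $n>B$ and $\gcd(n,r_1\cdots r_t)=1$. Then $$T^{(n)}_{\mathbf r,\mathbf h}(\alpha_{1,n},\dots,\alpha_{n-1,n})=n\,\mathsf S_0(\mathbf r,\mathbf h)-2^{H}.$$ In particular, for every fixed pattern, the cyclotomic cosine evaluation is an affine function of $n$ on the set of all such $n$.
   Context: A pattern $(\mathbf r,\mathbf h)$ consists of an integer $t\ge 1$, a tuple $\mathbf r=(r_1,\dots,r_t)$ of nonzero integers with $r_1=1$, and a tuple $\mathbf h=(h_1,\dots,h_t)$ of nonnegative integers. For $n\ge 2$ put $\Omega_n=\{1,\dots,n-1\}$ and $\alpha_{k,n}=\cos(2\pi k/n)$ for $k\in\Omega_n$. For an integer $r$ with $\gcd(r,n)=1$, let $\sigma_r:\Omega_n\to\Omega_n$ be the permutation determined by $\sigma_r(k)\equiv rk\pmod n$. If $\gcd(n,r_1\cdots r_t)=1$, the pattern sum is $$T^{(n)}_{\mathbf r,\mathbf h}(x_1,\dots,x_{n-1})=\sum_{k\in\Omega_n}\prod_{j=1}^t\bigl(2x_{\sigma_{r_j}(k)}\bigr)^{h_j}\in\mathbb{Q}[x_1,\dots,x_{n-1}].$$ $\mathsf S_M(\mathbf r,\mathbf h)$ denotes the coefficient of $u^M$ in the Laurent polynomial $\prod_{j=1}^t(u^{r_j}+u^{-r_j})^{h_j}$;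 in particular $\mathsf S_0(\mathbf r,\mathbf h)$ is its constant coefficient. *)

(* Defs.v *)
From mathcomp Require Import all_boot all_order all_algebra.
From mathcomp Require Import boolp classical_sets reals trigo.
From mathcomp Require Import mpoly.

Set Implicit Arguments.
Unset Strict Implicit.
Unset Printing Implicit Defensive.

Import Order.TTheory GRing.Theory Num.Theory.
Local Open Scope ring_scope.

Local Notation "x %:F" := (tofrac x).

(* The entries r_1, ..., r_t of a pattern are tnth r 0, ..., tnth r (t - 1),   *)
(* so that r_1 is r`_0.                                                        *)
Definition is_pattern (t : nat) (r : t.-tuple int) (h : t.-tuple nat) : Prop :=
  [/\ (1 <= t)%N, r`_0 = 1 & forall j : 'I_t, tnth r j != 0].

Definition pattern_H (t : nat) (h : t.-tuple nat) : nat :=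
  (\sum_(j < t) tnth h j)%N.

Definition pattern_B (t : nat) (r : t.-tuple int) (h : t.-tuple nat) : nat :=
  (\sum_(j < t) tnth h j * `|tnth r j|)%N.

(* Omega_n = {1, ..., n-1} is encoded by the type 'I_n.-1, with i : 'I_n.-1    *)
(* standing for the integer k = i.+1.                                          *)
Definition Omega (n : nat) : finType := 'I_n.-1.

Definition Omega_val (n : nat) (k : Omega n) : nat := (nat_of_ord k).+1.

(* The value k of odflt is never reached when r is coprime to n; see sigmaP.   *)
Definition sigma (n : nat) (r : int) (k : Omega n) : Omega n :=
  odflt k [pick l : Omega n |
    (Posz (Omega_val l) == r * Posz (Omega_val k) %[mod Posz n])%Z].

Lemma Omega_val_inj_mod (n : nat) (k l : Omega n) :
  (Posz (Omega_val k) = Posz (Omega_val l) %[mod Posz n])%Z -> k = l.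
Proof.
case: n k l => [|n] k l; first by case: k.
have small (i : Omega n.+1) : (Omega_val i < n.+1)%N.
  by rewrite /Omega_val ltnS ltn_ord.
rewrite !modz_nat !modn_small // => -[kl].
exact/val_inj.
Qed.

Lemma sigmaP (n : nat) (r : int) (k : Omega n) : coprimez n r ->
  (Posz (Omega_val (sigma r k)) = r * Posz (Omega_val k) %[mod Posz n])%Z.
Proof.
move=> co; rewrite /sigma; case: pickP => [l /eqP //|/= none].
case: n k co none => [|n] k co none; first by case: (k).
have kn : (Omega_val k < n.+1)%N by rewrite /Omega_val ltnS ltn_ord.
have [m em] : exists m : int, ((r * Posz (Omega_val k)) %% Posz n.+1)%Z = m.
  by eexists.
have m_ge0 : 0 <= m by rewrite -em modz_ge0.
have m_lt : m < Posz n.+1 by rewrite -em ltz_pmod.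
have m_neq0 : m != 0.
  rewrite -em; apply/negP => /eqP/dvdz_mod0P; rewrite Gauss_dvdzr // dvdzE /= => dv.
  by have := dvdn_leq (ltn0Sn _) dv; rewrite leqNgt kn.
case: m em m_ge0 m_lt m_neq0 => // [[|m]] // em _ ml _.
have mn : (m < n)%N by [].
have := none (Ordinal mn : Omega n.+1).
by rewrite /Omega_val /= em modz_nat modn_small // eqxx.
Qed.

Lemma sigma_bij (n : nat) (r : int) : coprimez n r -> bijective (@sigma n r).
Proof.
move=> co; apply: injF_bij => k l kl; apply: Omega_val_inj_mod.
apply/eqP; rewrite eqz_mod_dvd.
rewrite -(Gauss_dvdzr _ co) mulrBr -eqz_mod_dvd.
by rewrite -!(sigmaP _ co) kl.
Qed.

(* The variable x_k with k = i.+1 is 'X_i. The term is meaningful when n is    *)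
(* coprime to all the r_j.                                                     *)
Definition pattern_sum (n t : nat) (r : t.-tuple int) (h : t.-tuple nat) :
    {mpoly rat[n.-1]} :=
  \sum_(k : Omega n) \prod_(j < t) (2 *: 'X_(sigma (tnth r j) k)) ^+ tnth h j.

Definition pattern_sum_eval (R : realType) (n t : nat)
    (r : t.-tuple int) (h : t.-tuple nat) (x : Omega n -> R) : R :=
  (map_mpoly (ratr : rat -> R) (pattern_sum n r h)).@[x].

Definition alpha (R : realType) (n : nat) (k : Omega n) : R :=
  cos (2 * pi * (Omega_val k)%:R / n%:R).

(* Laurent polynomials are handled inside the field of rational functions      *)
(* over int: f is a Laurent polynomial when f * u ^+ N is a polynomial for     *)
(* some N.                                                                     *)
Definition laurent_u : {fraction {poly int}} := 'X%:F.

(* Coefficient of u ^ M in f: the coefficient of index M + N of p, if          *)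
(* f = u ^ (- N) * p.                                                          *)
Definition is_laurent_coef (f : {fraction {poly int}}) (M c : int) : Prop :=
  exists (N : nat) (p : {poly int}), f * laurent_u ^+ N = p%:F /\
    c = if M + N%:Z is Posz i then p`_i else 0.

Definition laurent_coef (f : {fraction {poly int}}) (M : int) : int :=
  xget 0 (is_laurent_coef f M).

Lemma is_laurent_coef_uniq (f : {fraction {poly int}}) (M c d : int) :
  is_laurent_coef f M c -> is_laurent_coef f M d -> c = d.
Proof.
move=> [N [p [fp ->]]] [N' [q [fq ->]]].
have pq : p * 'X^N' = q * 'X^N.
  apply/eqP; rewrite -tofrac_eq !rmorphM !rmorphXn /= -fp -fq.
  by rewrite -!mulrA [laurent_u ^+ N * _]mulrC.
have coefE (s : {poly int}) (A A' : nat) : 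
    (if M + A%:Z is Posz i then s`_i else 0) =
    (if M + (A + A')%N%:Z is Posz i then (s * 'X^A')`_i else 0).
  rewrite PoszD addrA; case: (M + A) => i /=.
    by rewrite coefMXn ltnNge leq_addl /= addnK.
  case E: (Negz i + A') => [m|//]; rewrite coefMXn.
  suff -> : (m < A')%N by [].
  by rewrite -ltz_nat -E NegzE addrC ltrBlDr ltrDl.
by rewrite (coefE p N N') (coefE q N' N) pq addnC.
Qed.

Lemma laurent_coefE (f : {fraction {poly int}}) (M c : int) :
  is_laurent_coef f M c -> laurent_coef f M = c.
Proof.
move=> fc; apply: (@is_laurent_coef_uniq f M) => //.
exact: (@xgetPex _ 0 (is_laurent_coef f M) (ex_intro _ c fc)).
Qed.

Definition pattern_S (M : int) (t : nat) (r : t.-tuple int) (h : t.-tuple nat) :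
    int :=
  laurent_coef
    (\prod_(j < t) (laurent_u ^ tnth r j + laurent_u ^ (- tnth r j)) ^+ tnth h j)
    M.

Lemma exprzDN_normr (F : fieldType) (u : F) (m : int) : u != 0 ->
  (u ^ m + u ^ (- m)) * u ^+ absz m = u ^+ (absz m).*2 + 1.
Proof.
move=> u0; rewrite mulrDl -addnn exprD.
have uV (i : nat) : u ^- i * u ^+ i = 1 by rewrite mulVf // expf_neq0.
case: m => i; first by rewrite -exprnN -exprnP /= uV.
by rewrite NegzE opprK -exprnN -exprnP abszN /= uV addrC.
Qed.

Lemma is_laurent_coef_pattern_S (M : int) (t : nat) (r : t.-tuple int)
    (h : t.-tuple nat) :
  is_laurent_coef
    (\prod_(j < t) (laurent_u ^ tnth r j + laurent_u ^ (- tnth r j)) ^+ tnth h j)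
    M (pattern_S M r h).
Proof.
set f := \prod_(j < t) _.
have u0 : laurent_u != 0 by rewrite tofrac_eq0 polyX_eq0.
have [N [p fp]] : exists (N : nat) (p : {poly int}), f * laurent_u ^+ N = p%:F.
  rewrite /f; elim/big_ind: _.
  - by exists 0%N, 1; rewrite mulr1 tofrac1.
  - move=> x y [N [p xp]] [N' [q yq]]; exists (N + N')%N, (p * q).
    by rewrite exprD mulrACA xp yq tofracM.
  - move=> j _; elim: (tnth h j) => [|m [N [p IH]]].
      by exists 0%N, 1; rewrite expr0 mulr1 tofrac1.
    exists (`|tnth r j|%N + N)%N, (('X^((absz (tnth r j)).*2) + 1) * p).
    rewrite exprS exprD mulrACA IH tofracM tofracD tofrac1 tofracXn.
    by congr (_ * _); apply: exprzDN_normr.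
apply: (@xgetPex _ 0 (is_laurent_coef f M)).
by eexists; exists N, p; split.
Qed.

Definition admissible (t : nat) (r : t.-tuple int) (h : t.-tuple nat) (n : nat) :
    Prop :=
  [/\ (2 <= n)%N, (pattern_B r h < n)%N
    & coprimez n (\prod_(j < t) tnth r j)].

(* Main.v *)
(* With z = exp(2 i pi / n) one has 2 cos(2 pi r k / n) = (z^k)^r + (z^k)^(-r),  *)
(* so that the pattern sum is the sum over k = 1, ..., n-1 of f(z^k), where f   *)
(* is the Laurent polynomial prod_j (u^r_j + u^-r_j)^h_j. Adding the term       *)
(* f(1) = 2^H of k = 0 gives the sum of f over all n-th roots of unity, that    *)
(* is, n times the sum of the coefficients of f whose exponent is divisible by  *)
(* n. All exponents of f lie in [-B, B] and B < n, so only the constant         *)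
(* coefficient survives.                                                        *)
Require Import Defs.
From mathcomp Require Import all_boot all_order all_algebra.
From mathcomp Require Import reals trigo mpoly complex lra.

Set Implicit Arguments.
Unset Strict Implicit.
Unset Printing Implicit Defensive.

Import Order.TTheory GRing.Theory Num.Theory.
Local Open Scope ring_scope.

(** Negative exponents are cleared by working with [pattern_numer], which is u^B f: it has degree at
    most 2B, and its coefficient of index B is the constant coefficient of f ([pattern_S0E]).
    Orthogonality of the powers of a primitive n-th root of unity ([prim_root_sum_expr]) then gives
    the full sum of f in any field containing such a root ([prim_root_sum_pattern]). The theorem is
    the case of [cos_root] in [R[i]], with the term f(1) removed ([pattern_sum_eval_alpha]). *)

Lemma prod_exprzDN_normr (F : fieldType) (w : F) (t : nat) (r : t.-tuple int)
    (h : t.-tuple nat) : w != 0 ->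
  (\prod_(j < t) (w ^ tnth r j + w ^ (- tnth r j)) ^+ tnth h j) *
    w ^+ pattern_B r h
  = \prod_(j < t) (w ^+ (absz (tnth r j)).*2 + 1) ^+ tnth h j.
Proof.
move=> w0; rewrite /pattern_B expr_sum -big_split /=.
by apply: eq_bigr => j _; rewrite mulnC exprM -exprMn exprzDN_normr.
Qed.

(* u ^ B times the Laurent polynomial of the pattern. *)
Definition pattern_numer (t : nat) (r : t.-tuple int) (h : t.-tuple nat) :
    {poly int} :=
  \prod_(j < t) ('X^((absz (tnth r j)).*2) + 1) ^+ tnth h j.

Lemma size_pattern_numer (t : nat) (r : t.-tuple int) (h : t.-tuple nat) :
  (size (pattern_numer r h) <= (pattern_B r h).*2.+1)%N.
Proof.
rewrite /pattern_numer /pattern_B; elim/big_ind2: _ => [|m p n q mp nq|j _].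
- by rewrite size_polyC oner_neq0.
- apply: leq_trans (size_polyMleq _ _) _.
  rewrite doubleD -subn1 leq_subLR add1n -addSn -addnS.
  exact: leq_add.
- apply: leq_trans (size_poly_exp_leq _ _) _.
  rewrite ltnS doubleMr mulnC leq_mul2l; apply/orP; right.
  rewrite -subn1 leq_subLR; apply: leq_trans (size_polyD _ _) _.
  by rewrite size_polyXn size_polyC oner_neq0 geq_max leqnn.
Qed.

Lemma pattern_S0E (t : nat) (r : t.-tuple int) (h : t.-tuple nat) :
  pattern_S 0 r h = (pattern_numer r h)`_(pattern_B r h).
Proof.
apply: laurent_coefE; exists (pattern_B r h), (pattern_numer r h); split=> //.
rewrite prod_exprzDN_normr ?tofrac_eq0 ?polyX_eq0 // rmorph_prod /=.
by apply: eq_bigr => j _; rewrite tofracXn tofracD tofracXn tofrac1.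
Qed.

Lemma prim_root_sum_expr (F : fieldType) (n i j : nat) (z : F) :
  n.-primitive_root z ->
  \sum_(k < n) (z ^+ k) ^+ i / (z ^+ k) ^+ j
  = if i == j %[mod n] then n%:R else 0.
Proof.
move=> zP; have z0 := prim_root_eq0 zP.
have {}z0 : z != 0 by rewrite z0 -lt0n (prim_order_gt0 zP).
rewrite -(eq_prim_root_expr zP).
under eq_bigr => k _ do rewrite -exprM -exprM mulnC [(k * j)%N]mulnC !exprM -expr_div_n.
case: eqP => [->|/eqP ne].
  under eq_bigr => k _ do rewrite divff ?expf_neq0 // expr1n.
  by rewrite sumr_const card_ord.
(* Geometric sum: x is an n-th root of unity other than 1, and x - 1 times the sum is x^n - 1 =
   0. *)
set x := _ / _; have x1 : x - 1 != 0.
  by rewrite subr_eq0 -(inj_eq (mulIf (expf_neq0 j z0))) divfK ?expf_neq0 ?mul1r.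
apply: (mulfI x1); rewrite -subrX1 mulr0 expr_div_n -!exprM mulnC exprM.
by rewrite [(j * n)%N]mulnC exprM (prim_expr_order zP) !expr1n divr1 subrr.
Qed.

Lemma prim_root_sum_pattern (F : fieldType) (n t : nat) (r : t.-tuple int)
    (h : t.-tuple nat) (z : F) :
  n.-primitive_root z -> (pattern_B r h < n)%N ->
  \sum_(k < n) \prod_(j < t)
     ((z ^+ k) ^ tnth r j + (z ^+ k) ^ (- tnth r j)) ^+ tnth h j
  = n%:R * (pattern_S 0 r h)%:~R.
Proof.
move=> zP Bn; have z0 : z != 0.
  by rewrite (prim_root_eq0 zP) -lt0n (prim_order_gt0 zP).
set B := pattern_B r h in Bn *; pose p := pattern_numer r h.
transitivity (\sum_(k < n) \sum_(i < B.*2.+1)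
    (p`_i)%:~R * ((z ^+ k) ^+ i / (z ^+ k) ^+ B)).
  apply: eq_bigr => k _; have zk0 : z ^+ k != 0 by rewrite expf_neq0.
  apply: (mulIf (expf_neq0 B zk0)); rewrite prod_exprzDN_normr // mulr_suml.
  transitivity (map_poly intr p).[z ^+ k].
    rewrite /p /pattern_numer rmorph_prod horner_prod; apply: eq_bigr => j _.
    by rewrite rmorphXn rmorphD /= map_polyXn rmorph1 !hornerE.
  rewrite (@horner_coef_wide _ B.*2.+1).
    by apply: eq_bigr => i _; rewrite coef_map mulrA divfK // expf_neq0.
  exact: leq_trans (size_poly _ _) (size_pattern_numer _ _).
rewrite exchange_big /=; have BB : (B < B.*2.+1)%N by rewrite ltnS -addnn leq_addr.
(* For 0 <= i <= 2B the distance from i to B is at most B < n, so i = B is the only index congruent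
   to B modulo n. *)
rewrite (bigD1 (Ordinal BB)) //= [X in _ + X]big1 => [|i iB].
  rewrite -mulr_sumr prim_root_sum_expr // eqxx addr0 mulrC pattern_S0E //.
rewrite -mulr_sumr prim_root_sum_expr // ifN ?mulr0 //; move: iB.
rewrite -val_eqE /=; apply: contra => ie.
have iB2 : (i <= B.*2)%N by rewrite -ltnS.
case: (leqP B i) => [Bi|iB].
  have := ie; rewrite eqn_mod_dvd // => dv.
  have : (i - B < n)%N by apply: leq_ltn_trans Bn; rewrite leq_subLR addnn.
  move: dv; case: (posnP (i - B)) => [e _ _|iB0 /dvdn_leq -/(_ iB0)].
    by rewrite eqn_leq Bi -subn_eq0 e eqxx.
  by rewrite leqNgt => /negbTE ->.
by move: ie; rewrite !modn_small // (ltn_trans iB).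
Qed.

Section Root.
Variables (R : realType) (n : nat).

Definition cos_root : R[i] :=
  (cos (2 * pi / n%:R) +i* sin (2 * pi / n%:R))%C.

Lemma cos_rootX k : cos_root ^+ k
  = (cos (2 * pi * k%:R / n%:R) +i* sin (2 * pi * k%:R / n%:R))%C.
Proof.
elim: k => [|k IH]; first by rewrite mulr0 mul0r cos0 sin0.
have -> : 2 * pi * k.+1%:R / n%:R = 2 * pi / n%:R + 2 * pi * k%:R / n%:R :> R.
  by rewrite -mulrDl -[X in X + _]mulr1 -mulrDr nat1r.
rewrite exprS IH cosD sinD; congr (_ +i* _)%C.
by rewrite addrC.
Qed.

Lemma cos_root_prim : (0 < n)%N -> n.-primitive_root cos_root.
Proof.
move=> n0; have nR : n%:R != 0 :> R by rewrite pnatr_eq0 -lt0n.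
apply/andP; split=> //; apply/forallP => k; rewrite unity_rootE cos_rootX eq_complex /=.
case: (ltngtP k.+1 n) => [kn||->]; last 1 first.
- rewrite mulfK // mulr_natl.
  by rewrite cos2pi sin2pi !eqxx.
- apply/eqP; apply/negbTE; rewrite negb_and; apply/orP; left.
  have -> : 2 * pi * k.+1%:R / n%:R = (pi * k.+1%:R / n%:R : R) *+ 2.
    by rewrite -[RHS]mulr_natl !mulrA.
  (* With x = pi (k+1) / n strictly between 0 and pi, cos (2x) = 1 - 2 sin^2 x < 1, so no earlier
     power equals 1. *)
  rewrite cos_mulr2n; set x := _ / _.
  have sx : 0 < sin x.
    apply: sin_gt0_pi; rewrite divr_gt0 ?mulr_gt0 ?pi_gt0 ?ltr0n //=.
    by rewrite ltr_pdivrMr ?ltr0n // ltr_pM2l ?pi_gt0 // ltr_nat.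
  by apply/negbT/lt_eqF; have := exprn_gt0 2 sx; rewrite cos2sin2; lra.
- by rewrite ltnNge ltn_ord.
Qed.

End Root.

(** Allows the index [sigma r k], known only modulo n, to be replaced by r k in exponents of z. *)
Lemma expz_mod_root (F : fieldType) (n : nat) (z : F) (a b : int) :
  z != 0 -> z ^+ n = 1 -> (a = b %[mod Posz n])%Z -> z ^ a = z ^ b.
Proof.
move=> z0 zn ab; suff E c : z ^ c = z ^ (c %% n)%Z by rewrite E ab -E.
rewrite {1}(divz_eq c n) expfzDr // [(c %/ n)%Z * n]mulrC -exprz_exp.
by rewrite (zn : z ^ n = 1) exp1rz mul1r.
Qed.

Lemma double_cos_root (R : realType) (n : nat) (m : nat) :
  let z := cos_root R n ^+ m in
  (2 * cos (2 * pi * m%:R / n%:R) : R)%:C%C = z + z^-1.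
Proof.
move=> z.
(* As z lies on the unit circle, its inverse is its conjugate. *)
have zz : (cos (2 * pi * m%:R / n%:R) -i* sin (2 * pi * m%:R / n%:R))%C * z = 1 :> R[i].
  rewrite /z cos_rootX; apply/eqP; rewrite eq_complex /=.
  by rewrite mulNr opprK -!expr2 cos2Dsin2 mulrC mulNr subrr !eqxx.
have z0 : z != 0 by apply/eqP => z0; move/eqP: zz; rewrite z0 mulr0 eq_sym oner_eq0.
rewrite -[z^-1]mul1r -zz mulfK // /z cos_rootX; apply/eqP; rewrite eq_complex /=.
by rewrite mulr_natl mulr2n subrr !eqxx.
Qed.

Lemma pattern_sum_evalE (R : realType) (n t : nat) (r : t.-tuple int)
    (h : t.-tuple nat) (x : Omega n -> R) :
  pattern_sum_eval r h x
  = \sum_(k : Omega n) \prod_(j < t) (2 * x (sigma (tnth r j) k)) ^+ tnth h j.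
Proof.
rewrite /pattern_sum_eval /pattern_sum.
rewrite (rmorph_sum (@map_mpoly n.-1 rat R ratr)) rmorph_sum /=.
apply: eq_bigr => k _.
rewrite (rmorph_prod (@map_mpoly n.-1 rat R ratr)) rmorph_prod /=.
apply: eq_bigr => j _.
rewrite (rmorphXn (@map_mpoly n.-1 rat R ratr)) rmorphXn /=.
by rewrite map_mpolyZ map_mpolyX mevalZ mevalXU rmorph_nat.
Qed.

Lemma pattern_sum_eval_alpha (R : realType) (n t : nat) (r : t.-tuple int)
    (h : t.-tuple nat) : admissible r h n ->
  pattern_sum_eval r h (@alpha R n)
  = n%:R * (pattern_S 0 r h)%:~R - 2 ^+ pattern_H h.
Proof.
case: n => [[]//|n] [n2 Bn co]; have zP := @cos_root_prim R n.+1 isT.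
set z := cos_root R n.+1 in zP; have z0 : z != 0.
  by rewrite (prim_root_eq0 zP).
have co_j j : coprimez n.+1 (tnth r j).
  by move: co; rewrite (bigD1 j) //= coprimezMr => /andP[].
apply: complexI; rewrite rmorphB rmorphM rmorphXn !rmorph_nat rmorph_int /=.
rewrite -(prim_root_sum_pattern zP Bn) pattern_sum_evalE rmorph_sum /=.
(* The term k = 0 is f(1) = 2^H and cancels the subtracted power; the remaining indices, shifted by
   one, are those of [Omega]. *)
rewrite big_ord_recl expr0 [X in _ = X + _ - _](_ : _ = 2 ^+ pattern_H h).
  rewrite addrAC subrr add0r; apply: eq_bigr => k _.
  rewrite rmorph_prod; apply: eq_bigr => j _.
  have zs : z ^+ Omega_val (@sigma n.+1 (tnth r j) k) = (z ^+ k.+1) ^ tnth r j.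
    rewrite !exprnP exprz_exp mulrC.
    exact: (expz_mod_root z0 (prim_expr_order zP) (sigmaP _ (co_j j))).
  by rewrite rmorphXn /= /alpha double_cos_root -/z zs invr_expz.
rewrite /pattern_H expr_sum; apply: eq_bigr => j _.
by rewrite !exp1rz.
Qed.

Theorem theorem4p1 (R : realType) (t : nat) (r : t.-tuple int)
    (h : t.-tuple nat) (pat : is_pattern r h) :
  (forall n : nat, admissible r h n ->
     pattern_sum_eval r h (@alpha R n)
       = n%:R * (pattern_S 0 r h)%:~R - 2 ^+ pattern_H h)
  /\ (exists a b : R, forall n : nat, admissible r h n ->
        pattern_sum_eval r h (@alpha R n) = a * n%:R + b).
Proof.
split=> [n|]; first exact: pattern_sum_eval_alpha.
exists (pattern_S 0 r h)%:~R, (- 2 ^+ pattern_H h) => n adm.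
by rewrite pattern_sum_eval_alpha // mulrC.
Qed.
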